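(* Let $A\in\mathbb{R}^{n\times n}$, $B\in\mathbb{R}^{n\times m}$ with $m\le n$, let $(A,B)$ be controllable, let $W\subseteq\mathbb{R}^n$ be nonempty, and let $X\subseteq\mathbb{R}^n$ and $U\subseteq\mathbb{R}^m$ be compact. Let $\varepsilon\in\mathbb{R}_{>0}$ and put $$\bar X_\varepsilon=\{x\in\mathbb{R}^n\mid x+\varepsilon\mathbb{B}\subseteq X\},\qquad \bar U_\varepsilon=\{u\in\mathbb{R}^m\mid u+\varepsilon\mathbb{B}\subseteq U\}.$$ Then there exists $\rho\in\mathbb{R}_{>0}$ such that for any set $\bar R_\varepsilon\subseteq\bar X_\varepsilon$ satisfying $$x\in\bar R_\varepsilon\ \Longrightarrow\ \exists u\in\bar U_\varepsilon:\ Ax+Bu+W\subseteq\bar R_\varepsilon,$$ we have $\bar R_\varepsilon\subseteq R_{i+1}^\rho$ for every $i\in\mathbb{Z}_{\ge0}$ satisfying $R_i^\rho\subseteq R_{i+1}^\rho+\rho\mathbb{B}$.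
   Context: $\mathbb{B}$ denotes the closed unit ball of the infinity norm (in $\mathbb{R}^n$ or $\mathbb{R}^m$ according to context). Sums of sets are Minkowski sums (a sum with the empty set is empty), and $x+W$ means $\{x\}+W$. $(A,B)$ is controllable if $[B,AB,\dots,A^{n-1}B]$ has rank $n$. For $\rho\in\mathbb{R}_{\ge0}$ and $R\subseteq\mathbb{R}^n$, $\operatorname{pre}_\rho(R)=\{x\in\mathbb{R}^n\mid \exists u\in U:\ Ax+Bu+W+\rho\mathbb{B}\subseteq R\}$. The sequence $(R_i^\rho)_{i\in\mathbb{Z}_{\ge0}}$ is defined by $R_0^\rho=X$, $R_{i+1}^\rho=\operatorname{pre}_\rho(R_i^\rho)\cap X$. *)

(* Defs.v *)
From HB Require Import structures.
From mathcomp Require Import all_boot all_order all_algebra.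
From mathcomp Require Import all_classical all_reals all_analysis.
Import Order.TTheory GRing.Theory Num.Theory numFieldNormedType.Exports.

Set Implicit Arguments.
Unset Strict Implicit.
Unset Printing Implicit Defensive.

Local Open Scope classical_set_scope.
Local Open Scope ring_scope.

Definition minkowski_sum (V : zmodType) (S T : set V) : set V :=
  [set s + t | s in S & t in T].

Notation "S `(+)` T" := (minkowski_sum S T)
  (at level 50, left associativity) : classical_set_scope.

Definition scale_set (R : realType) (V : lmodType R) (a : R) (S : set V) :
    set V :=
  [set a *: s | s in S].

(* The norm of matrices is the maximum of the absolute values of the entries,
   hence the infinity norm on column vectors. *)
Definition unit_ball (R : realType) (n : nat) : set 'cV[R]_n :=
  [set x | `|x| <= 1].
Arguments unit_ball {R n}.

Definition controllability_matrix (R : realType) (n m : nat)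
    (A : 'M[R]_n) (B : 'M[R]_(n, m)) :=
  \mxrow_(k < n) (A ^+ k *m B).

Definition controllable (R : realType) (n m : nat)
    (A : 'M[R]_n) (B : 'M[R]_(n, m)) : Prop :=
  \rank (controllability_matrix A B) = n.

Definition pre (R : realType) (n m : nat) (A : 'M[R]_n) (B : 'M[R]_(n, m))
    (U : set 'cV[R]_m) (W : set 'cV[R]_n) (rho : R) (S : set 'cV[R]_n) :
    set 'cV[R]_n :=
  [set x | exists u, U u /\
     [set A *m x + B *m u] `(+)` W `(+)` scale_set rho unit_ball `<=` S].

Fixpoint Rseq (R : realType) (n m : nat) (A : 'M[R]_n) (B : 'M[R]_(n, m))
    (X : set 'cV[R]_n) (U : set 'cV[R]_m) (W : set 'cV[R]_n) (rho : R)
    (i : nat) : set 'cV[R]_n :=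
  match i with
  | 0%N => X
  | j.+1 => pre A B U W rho (Rseq A B X U W rho j) `&` X
  end.

(* The tightened sets: X-bar_eps and U-bar_eps are [shrink X eps] and
   [shrink U eps]. *)
Definition shrink (R : realType) (n : nat) (S : set 'cV[R]_n) (eps : R) :
    set 'cV[R]_n :=
  [set x | [set x] `(+)` scale_set eps unit_ball `<=` S].

(* Main.v *)
Require Import Defs.
From HB Require Import structures.
From mathcomp Require Import all_boot all_order all_algebra.
From mathcomp Require Import all_classical all_reals all_analysis.
Import Order.TTheory GRing.Theory Num.Theory numFieldNormedType.Exports.
Set Implicit Arguments.
Unset Strict Implicit.
Unset Printing Implicit Defensive.
Local Open Scope classical_set_scope.
Local Open Scope ring_scope.

(* Disturbance feedback.  By controllability, the effect of an additional
   disturbance d can be steered to zero in n steps by inputs C_k d; let M_k d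
   be its remaining effect after k steps, so M_0 = 1 and M_n = 0.  The set E of
   the sums of M_k d_k (k < n) with |d_k| <= rho then satisfies: for every e in
   E there is v with A e + B v + rho ball contained in E.  For small rho, e and
   v have norm at most eps, so Rbar + E is a subset of X that is invariant
   under the disturbance set W + rho ball, hence contained in every R_i. *)

(** The factor [n] appears because the norm is the largest absolute entry and each entry of the
    product is a sum of [n] terms. *)
Lemma mulmx_norm_le (R : realType) (m n p : nat) (M : 'M[R]_(m, n))
    (N : 'M[R]_(n, p)) : `|M *m N| <= n%:R * `|M| * `|N|.
Proof.
have entry_le a b (P : 'M[R]_(a, b)) i j : `|P i j| <= `|P|.
  rewrite [leRHS]mx_normrE.
  exact: (@le_bigmax _ _ _ 0 (fun ij : 'I_a * 'I_b => `|P ij.1 ij.2|) (i, j)).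
rewrite [leLHS]mx_normrE; apply: bigmax_le => [|[i j] _ /=].
  by rewrite !mulr_ge0.
rewrite mxE (le_trans (ler_norm_sum _ _ _))//.
rewrite -mulrA mulr_natl -[n in _ *+ n]card_ord -sumr_const.
by apply: ler_sum => k _; rewrite normrM ler_pM.
Qed.

(** Full row rank gives the controllability matrix a right inverse; the [D k] are its row blocks. *)
Lemma controllable_right_inverse (R : realType) (n m : nat) (A : 'M[R]_n)
    (B : 'M[R]_(n, m)) : controllable A B ->
  exists D : nat -> 'M[R]_(m, n), \sum_(k < n) A ^+ k *m B *m D k = 1%:M.
Proof.
move=> hAB; have /row_freeP[D] : row_free (controllability_matrix A B).
  exact/eqP.
rewrite /controllability_matrix -[D]submxcolK mul_mxrow_mxcol => D1.
(* The blocks are extended by 0 to all natural indices, which allows index arithmetic without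
   ordinals. *)
exists (fun k => oapp (submxcol D) 0 (insub k)); rewrite -[RHS]D1.
by apply: eq_bigr => k _; rewrite valK.
Qed.

Fixpoint disturbance_response (R : realType) (n m : nat) (A : 'M[R]_n)
    (B : 'M[R]_(n, m)) (C : nat -> 'M[R]_(m, n)) (k : nat) : 'M[R]_n :=
  if k is j.+1 then A *m disturbance_response A B C j + B *m C j else 1%:M.

(** Unrolled recursion: the input given by [C (k - j.+1)] has been propagated [j] times by [A] at
    step [k]. *)
Lemma disturbance_responseE (R : realType) (n m : nat) (A : 'M[R]_n)
    (B : 'M[R]_(n, m)) (C : nat -> 'M[R]_(m, n)) (k : nat) :
  disturbance_response A B C k =
    A ^+ k + \sum_(j < k) A ^+ j *m B *m C (k - j.+1)%N.
Proof.
elim: k => [|k /= ->]; first by rewrite big_ord0 addr0.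
rewrite big_ord_recl expr0 mul1mx subn1 mulmxDr exprS -addrA; congr (_ + _).
rewrite addrC mulmx_sumr; congr (_ + _); apply: eq_bigr => j _.
by rewrite !mulmxA lift0 exprS subSS.
Qed.

Lemma controllable_deadbeat (R : realType) (n m : nat) (A : 'M[R]_n)
    (B : 'M[R]_(n, m)) : controllable A B ->
  exists C : nat -> 'M[R]_(m, n), disturbance_response A B C n = 0.
Proof.
move=> /controllable_right_inverse[D D1].
(* Index reversal matches the closed form: the inputs contribute minus the sum of
   [A ^+ j *m B *m D j], times [A ^+ n], which cancels the free response [A ^+ n]. *)
exists (fun j => - (D (n - j.+1)%N *m A ^+ n)); rewrite disturbance_responseE.
rewrite -[X in X + _]mul1mx -D1 mulmx_suml -big_split big1//= => j _.
by rewrite subnSK// subKn 1?ltnW// mulmxN mulmxA subrr.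
Qed.

Lemma scale_ballP (R : realType) (n : nat) (a : R) (x : 'cV[R]_n) : 0 < a ->
  scale_set a unit_ball x <-> `|x| <= a.
Proof.
move=> a0; split=> [[y y1 <-]|xa].
  by rewrite normrZ gtr0_norm// ger_pMr.
exists (a^-1 *: x); last by rewrite scalerA divff ?gt_eqF// scale1r.
by rewrite /unit_ball/= normrZ gtr0_norm ?invr_gt0// mulrC ler_pdivrMr// mul1r.
Qed.

Lemma shrink_add (R : realType) (n : nat) (S : set 'cV[R]_n) (eps : R)
    (x e : 'cV[R]_n) : 0 < eps -> shrink S eps x -> `|e| <= eps -> S (x + e).
Proof.
move=> eps0 + exe; apply; exists x => //; exists e => //.
exact/scale_ballP.
Qed.

Lemma sum_mulmx_norm_le (R : realType) (m n p : nat)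
    (M : nat -> 'M[R]_(m, n)) (d : nat -> 'cV[R]_n) (rho : R) :
  (forall k, `|d k| <= rho) ->
  `|\sum_(k < p) M k *m d k| <= (\sum_(k < p) n%:R * `|M k|) * rho.
Proof.
move=> drho; rewrite (le_trans (ler_norm_sum _ _ _))// mulr_suml.
apply: ler_sum => k _; rewrite (le_trans (mulmx_norm_le _ _))//.
by rewrite ler_wpM2l// mulr_ge0.
Qed.

(** Induction on [i], since [pre] is monotone in its target set. *)
Lemma invariant_sub_Rseq (R : realType) (n m : nat) (A : 'M[R]_n)
    (B : 'M[R]_(n, m)) (X : set 'cV[R]_n) (U : set 'cV[R]_m)
    (W : set 'cV[R]_n) (rho : R) (S : set 'cV[R]_n) :
  S `<=` X -> S `<=` pre A B U W rho S ->
  forall i, S `<=` Rseq A B X U W rho i.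
Proof.
move=> SX Spre; elim=> [//|i IH] x Sx /=; split; last exact: SX.
have [u [Uu uS]] := Spre x Sx.
by exists u; split=> //; apply: subset_trans IH.
Qed.

Theorem theorem3 (R : realType) (n m : nat)
    (A : 'M[R]_n) (B : 'M[R]_(n, m)) (hmn : (m <= n)%N)
    (hAB : controllable A B)
    (W : set 'cV[R]_n) (hW : W !=set0)
    (X : set 'cV[R]_n) (U : set 'cV[R]_m) (hX : compact X) (hU : compact U)
    (eps : R) (heps : 0 < eps) :
  exists rho : R, 0 < rho /\
    forall Rbar : set 'cV[R]_n, Rbar `<=` shrink X eps ->
      (forall x, Rbar x ->
         exists u, shrink U eps u /\
           [set A *m x + B *m u] `(+)` W `<=` Rbar) ->
      forall i : nat,
        Rseq A B X U W rho i `<=`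
          Rseq A B X U W rho i.+1 `(+)` scale_set rho unit_ball ->
        Rbar `<=` Rseq A B X U W rho i.+1.
Proof.
have [C Mn0] := controllable_deadbeat hAB.
set M := disturbance_response A B C in Mn0.
(* [a * rho] will bound the elements of [E], and [b * rho] the corrections to the input. *)
pose a : R := \sum_(k < n) n%:R * `|M k|.
pose b : R := \sum_(k < n) n%:R * `|C k|.
have a0 : 0 <= a by apply: sumr_ge0 => k _; rewrite mulr_ge0.
have b0 : 0 <= b by apply: sumr_ge0 => k _; rewrite mulr_ge0.
have ab0 : 0 < 1 + a + b by rewrite -addrA ltr_wpDr// addr_ge0.
(* The summand 1 keeps the denominator positive even if [a] and [b] vanish. *)
pose rho := eps / (1 + a + b).
have rho0 : 0 < rho by rewrite divr_gt0.
have arho : a * rho <= eps.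
  rewrite mulrCA ler_piMr ?(ltW heps)// ler_pdivrMr// mul1r addrAC lerDr.
  exact: addr_ge0.
have brho : b * rho <= eps.
  by rewrite mulrCA ler_piMr ?(ltW heps)// ler_pdivrMr// mul1r lerDr addr_ge0.
exists rho; split=> // Rbar RbarX Rbar_inv i _.
pose E := [set e | exists2 d : nat -> 'cV[R]_n,
  (forall k, `|d k| <= rho) & e = \sum_(k < n) M k *m d k].
apply: (@subset_trans _ (Rbar `(+)` E)).
  move=> x Rx; exists x => //; exists 0; last exact: addr0.
  exists (fun=> 0) => [k|]; first by rewrite normr0 ltW.
  by rewrite big1// => k _; rewrite mulmx0.
apply: invariant_sub_Rseq => _ [x Rx [e [d drho ->] <-]].
  apply: (shrink_add heps); first exact: RbarX.
  by rewrite (le_trans (sum_mulmx_norm_le _ _ drho)).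
have [u [Uu uR]] := Rbar_inv x Rx.
(* The correction uses the same [d] that represents the deviation from [x]. *)
exists (u + \sum_(k < n) C k *m d k); split.
  apply: (shrink_add heps Uu).
  by rewrite (le_trans (sum_mulmx_norm_le _ _ drho)).
move=> _ [_ [_ -> [w Ww <-]] [f /scale_ballP-/(_ rho0) frho <-]].
exists (A *m x + B *m u + w).
  by apply: uR; exists (A *m x + B *m u) => //; exists w.
(* One time step ages every past disturbance by one and puts the new one, [f], at age 0. *)
pose d' k := if k is j.+1 then d j else f.
exists (\sum_(k < n) M k *m d' k); first by exists d' => // -[|k] /=.
(* The oldest disturbance drops out because [M n] is 0. *)
have -> : \sum_(k < n) M k *m d' k = \sum_(k < n.+1) M k *m d' k.
  by rewrite big_ord_recr/= Mn0 mul0mx addr0.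
have -> : \sum_(k < n.+1) M k *m d' k =
    f + (A *m \sum_(k < n) M k *m d k + B *m \sum_(k < n) C k *m d k).
  rewrite big_ord_recl/= mul1mx !mulmx_sumr -big_split/=; congr (_ + _).
  by apply: eq_bigr => k _; rewrite mulmxDl !mulmxA.
rewrite !mulmxDr [f + _]addrC !addrA; congr (_ + _).
by rewrite [LHS](ACl (1*4*2*5*3)).
Qed.
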